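(* Let $A$ be an $N\times N$ Hermitian matrix, let $k\ge 1$, let $\lambda\in\Lambda_k(A)$, and suppose that $\lambda$ is not an eigenvalue of $A$. Let $P_+$ and $P_-$ be the orthogonal projections onto the spans of the eigenvectors of $A-\lambda I$ for its positive and negative eigenvalues, respectively. Then: (1) $\dim P_+\mathbb{C}^N\ge k$ and $\dim P_-\mathbb{C}^N\ge k$. For every $k$-dimensional subspace $\mathcal{V}_+$ of $P_+\mathbb{C}^N$ and every linear isometry $U:\mathcal{V}_+\to P_-\mathbb{C}^N$, setting $\mathcal{V}=\{v_++Uv_+: v_+\in\mathcal{V}_+\}$ and $\mathcal{W}=|A-\lambda I|^{-1/2}\,\mathcal{V}$, the subspace $\mathcal{W}$ is $k$-dimensional and the orthogonal projection $P_{\mathcal{W}}$ onto $\mathcal{W}$ satisfies $P_{\mathcal{W}}AP_{\mathcal{W}}=\lambda P_{\mathcal{W}}$. (2) Conversely, every rank-$k$ orthogonal projection $P$ with $PAP=\lambda P$ is of the form $P=P_{\mathcal{W}}$ for some $\mathcal{W}$ obtained as in (1) from some choice of $\mathcal{V}_+$ and $U$.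
   Context: For an $N\times N$ complex matrix $T$ and an integer $k\ge 1$, the rank-$k$ numerical range of $T$ is $$\Lambda_k(T)=\{\lambda\in\mathbb{C}: PTP=\lambda P \text{ for some rank-}k\text{ projection } P \text{ on } \mathbb{C}^N\},$$ where ''projection'' means orthogonal projection. For Hermitian $A$, $\Lambda_k(A)\subseteq\mathbb{R}$. The operator $|A-\lambda I|^{-1/2}$ is defined by the functional calculus: it is $f(A-\lambda I)$ with $f(x)=|x|^{-1/2}$ for $x\ne 0$. *)

(* Defs.v *)
From HB Require Import structures.
From mathcomp Require Import all_boot all_order all_algebra.
From mathcomp Require Import spectral sesquilinear.
From mathcomp Require Import classical_sets reals.
From mathcomp.real_closed Require Export complex.

Set Implicit Arguments.
Unset Strict Implicit.
Unset Printing Implicit Defensive.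
Import Order.TTheory GRing.Theory Num.Theory.
Local Open Scope ring_scope.
Local Open Scope sesquilinear_scope.

(* Vectors of C^N are columns, on which matrices act on the left; subspaces of
   C^N are of type {vspace 'cV[C]_N}.  (The matrix spaces of mxalgebra and the
   inner product of spectral are about rows, hence are not used here.) *)

Section Defs.
Variables (C : numClosedFieldType) (N : nat).
Implicit Types (T P B : 'M[C]_N) (v : 'cV[C]_N) (W : {vspace 'cV[C]_N}).

Definition mxop T : 'End('cV[C]_N) := linfun (mulmx T).

Definition enorm v : C := sqrtC (\sum_(i < N) `|v i 0| ^+ 2).

Definition is_orthoproj P : Prop := P *m P = P /\ P \is hermsymmx.

Definition numrange (k : nat) T : set C :=
  [set lam | exists P, [/\ is_orthoproj P, \rank P = k
                         & P *m T *m P = lam *: P]]%classic.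

Definition basis_mx W : 'M[C]_(N, \dim W) :=
  \matrix_(i, j) (vbasis W)`_j i 0.

(* The orthogonal projection onto W, as Q (Q^* Q)^-1 Q^* where the columns of Q
   are a basis of W; see orthoprojP and orthoproj_uniq. *)
Definition orthoproj W : 'M[C]_N :=
  let Q := basis_mx W in Q *m invmx (Q ^t* *m Q) *m Q ^t*.

(* Functional calculus f(B), for B normal; see funcalc_eigen. *)
Definition funcalc (f : C -> C) B : 'M[C]_N :=
  invmx (spectralmx B) *m diag_mx (map_mx f (spectral_diag B)) *m spectralmx B.

Definition abs_invsqrt B : 'M[C]_N := funcalc (fun x => (sqrtC `|x|)^-1) B.

(* The span of the eigenvectors of B whose eigenvalue satisfies S, for B
   normal (spectral_diag B lists the eigenvalues of B); see eigspanP. *)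
Definition eigspan (S : pred C) B : {vspace 'cV[C]_N} :=
  (\sum_(i < N | S (spectral_diag B 0%R i))
     passmx.leigenspace (mxop B) (spectral_diag B 0%R i))%VS.

Definition posproj B : 'M[C]_N := orthoproj (eigspan (fun x => 0 < x) B).
Definition negproj B : 'M[C]_N := orthoproj (eigspan (fun x => x < 0) B).

Section Graph.
Variables (V1 V2 : {vspace 'cV[C]_N}) (U : 'Hom(subvs_of V1, subvs_of V2)).

Definition is_isometry : Prop := forall x, enorm (vsval (U x)) = enorm (vsval x).

(* {v + U v : v in V1}, as the image of the linear map v |-> v + U v. *)
Definition sumgraph : {vspace 'cV[C]_N} :=
  limg (linfun (@vsval _ _ V1) + (linfun (@vsval _ _ V2) \o U))%VF.

End Graph.

Lemma mxopE T v : mxop T v = T *m v.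
Proof. by rewrite lfunE. Qed.

Lemma memv_sumgraph (V1 V2 : {vspace 'cV[C]_N})
    (U : 'Hom(subvs_of V1, subvs_of V2)) v :
  reflect (exists x, v = vsval x + vsval (U x)) (v \in sumgraph U).
Proof.
apply: (iffP memv_imgP) => [[x _ ->]|[x ->]]; exists x; rewrite ?memvf //;
by rewrite add_lfunE comp_lfunE !lfunE.
Qed.

Lemma col_gram_eq0 n (x : 'cV[C]_n) : x ^t* *m x = 0 -> x = 0.
Proof.
move=> /matrixP /(_ 0 0); rewrite !mxE => /eqP.
rewrite psumr_eq0 => [/allP x0|i _]; last by rewrite !mxE mulrC mul_conjC_ge0.
apply/colP => i; rewrite mxE; apply/eqP.
by have := x0 i (mem_index_enum _); rewrite !mxE /= mulrC mul_conjC_eq0.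
Qed.

Lemma trC_mul m n p (X : 'M[C]_(m, n)) (Y : 'M[C]_(n, p)) :
  (X *m Y) ^t* = Y ^t* *m X ^t*.
Proof. by rewrite trmx_mul map_mxM. Qed.

Lemma basis_mx_mulE W (c : 'cV[C]_(\dim W)) :
  basis_mx W *m c = \sum_(j < \dim W) c j 0 *: (vbasis W)`_j.
Proof.
apply/colP => i; rewrite mxE summxE; apply: eq_bigr => j _.
by rewrite !mxE mulrC.
Qed.

Lemma basis_mxP W v :
  reflect (exists c : 'cV[C]_(\dim W), v = basis_mx W *m c) (v \in W).
Proof.
apply: (iffP idP) => [vW|[c ->]].
  exists (\col_j coord (vbasis W) j v); rewrite basis_mx_mulE.
  rewrite {1}(coord_vbasis vW); apply: eq_bigr => j _; rewrite mxE.
  by [].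
rewrite basis_mx_mulE; apply: memv_suml => j _; apply: memvZ.
by apply: vbasis_mem; rewrite mem_nth // size_tuple.
Qed.

Lemma basis_mx_inj W (c : 'cV[C]_(\dim W)) : basis_mx W *m c = 0 -> c = 0.
Proof.
rewrite basis_mx_mulE => c0; apply/colP => j; rewrite mxE.
by have /freeP/(_ (fun j => c j 0) c0)-> := basis_free (vbasisP W).
Qed.

Lemma basis_gram_unit W : (basis_mx W) ^t* *m basis_mx W \in unitmx.
Proof.
set Q := basis_mx W; rewrite -unitmx_tr -row_free_unit -kermx_eq0.
apply/eqP/row_matrixP => i; rewrite row0; set r := row i _.
have : r *m (Q ^t* *m Q)^T = 0.
  by apply/sub_kermxP; exact: row_sub.
move=> /(congr1 trmx); rewrite trmx_mul trmxK trmx0 => h.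
apply: trmx_inj; rewrite trmx0; apply: (@basis_mx_inj W).
apply: col_gram_eq0; rewrite trC_mul -mulmxA [X in _ *m X]mulmxA.
by rewrite h mulmx0.
Qed.

Lemma orthoprojP W :
  is_orthoproj (orthoproj W) /\ limg (mxop (orthoproj W)) = W.
Proof.
rewrite /is_orthoproj /orthoproj; set Q := basis_mx W.
have uG := basis_gram_unit W; rewrite -/Q in uG.
set G := Q ^t* *m Q in uG *.
have GH : G ^t* = G by rewrite /G trC_mul trmxCK.
have PQ : Q *m invmx G *m Q ^t* *m Q = Q.
  by rewrite -mulmxA -/G mulmxKV.
split; first split.
- by rewrite !mulmxA PQ.
- apply/is_hermitianmxP; rewrite expr0 scale1r !trC_mul trmxCK mulmxA.
  by rewrite trmx_inv map_invmx GH.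
apply/vspaceP => v; apply/memv_imgP/basis_mxP => [[u _ ->]|[c ->]].
  by exists (invmx G *m Q ^t* *m u); rewrite mxopE !mulmxA.
by exists (Q *m c); rewrite ?memvf // mxopE mulmxA PQ.
Qed.

Lemma orthoproj_uniq W P :
  is_orthoproj P -> limg (mxop P) = W -> P = orthoproj W.
Proof.
move=> [PP PH] PW; have [[RR RH] RW] := orthoprojP W.
set R := orthoproj W in RR RH RW *.
have fixR X Y : X *m X = X -> limg (mxop X) = W -> limg (mxop Y) = W ->
    X *m Y = Y.
  move=> XX XW YW; apply/matrixP => i j.
  have /memv_imgP[u _ e] : col j Y \in limg (mxop X).
    rewrite XW -YW; apply/memv_imgP; exists (delta_mx j 0); rewrite ?memvf //.
    by rewrite mxopE colE.
  have : X *m col j Y = col j Y by rewrite e !mxopE mulmxA XX.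
  by move=> /colP /(_ i); rewrite colE mulmxA -!colE !mxE.
have H (X : 'M[C]_N) : X \is hermsymmx -> X ^t* = X.
  by move=> /is_hermitianmxP; rewrite expr0 scale1r => <-.
have PR := fixR _ _ PP PW RW; have RP := fixR _ _ RR RW PW.
by rewrite -{1}(H _ PH) -{1}RP trC_mul (H _ PH) (H _ RH).
Qed.

Lemma spectral_normal B : B \is normalmx ->
  spectralmx B *m B = diag_mx (spectral_diag B) *m spectralmx B.
Proof.
move=> nB; rewrite {2}(orthomx_spectralP nB) !mulmxA.
by rewrite mulmxV ?mul1mx // spectral_unit.
Qed.

Lemma spectral_eigen B v mu i : B \is normalmx -> B *m v = mu *: v ->
  spectral_diag B 0 i != mu -> (spectralmx B *m v) i 0 = 0.
Proof.
move=> nB e ne; set w := spectralmx B *m v.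
have : diag_mx (spectral_diag B) *m w = mu *: w.
  by rewrite /w mulmxA -spectral_normal // -mulmxA e scalemxAr.
move=> /colP /(_ i); rewrite mul_diag_mx !mxE => /eqP.
by rewrite -subr_eq0 -mulrBl mulf_eq0 subr_eq0 (negPf ne) => /eqP.
Qed.

Lemma funcalc_eigen f B v mu :
  B \is normalmx -> B *m v = mu *: v -> funcalc f B *m v = f mu *: v.
Proof.
move=> nB e; set S := spectralmx B.
have uS : S \in unitmx by apply: spectral_unit.
rewrite /funcalc -/S -!mulmxA; suff -> :
    diag_mx (map_mx f (spectral_diag B)) *m (S *m v) = f mu *: (S *m v).
  by rewrite -scalemxAr mulmxA mulVmx ?mul1mx.
apply/colP => i; rewrite mul_diag_mx mxE [in LHS]mxE [RHS]mxE.
have [->//|ne] := eqVneq (spectral_diag B 0 i) mu.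
by rewrite (spectral_eigen nB e ne) !mulr0.
Qed.

Lemma eigspanP (S : pred C) B W : B \is normalmx ->
  reflect (forall mu v, S mu -> B *m v = mu *: v -> v \in W)
          (eigspan S B <= W)%VS.
Proof.
move=> nB; apply: (iffP subv_sumP) => [sW mu v Smu e|H i Si].
  have [->|v0] := eqVneq v 0; first exact: mem0v.
  case: (pickP (fun i => spectral_diag B 0 i == mu)) => [i /eqP ei|ne].
    apply: (subvP (sW i _)); rewrite ei //.
    rewrite memv_ker; apply/eqP; rewrite add_lfunE opp_lfunE scale_lfunE.
    by rewrite id_lfunE mxopE e subrr.
  case/negP: v0; apply/eqP.
  have uS : spectralmx B \in unitmx by apply: spectral_unit.
  rewrite -[v](mulKmx uS); suff -> : spectralmx B *m v = 0 by rewrite mulmx0.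
  apply/colP => i; rewrite (spectral_eigen nB e) ?mxE //.
  by have := ne i; move=> /= ->.
apply/subvP => v; rewrite memv_ker => /eqP.
rewrite add_lfunE opp_lfunE scale_lfunE id_lfunE mxopE => /eqP.
by rewrite subr_eq0 => /eqP; exact: H.
Qed.

End Defs.

(* Main.v *)
Require Import Defs.
From mathcomp Require Import all_boot all_order all_algebra.
From mathcomp Require Import spectral sesquilinear.
From mathcomp Require Import classical_sets reals.
Import Order.TTheory GRing.Theory Num.Theory.
Local Open Scope ring_scope.
Local Open Scope complex_scope.

(** Put B = A - lam I, S = |B|^(-1/2), and let P+, P- be the spectral projections
    of B, so that S B S = P+ - P-.  For a projection P, the equation
    P A P = lam P says that the quadratic form of B vanishes on the range of P;
    equivalently, the form |P+ v|^2 - |P- v|^2 vanishes on V = S^-1 (range of P).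
    A subspace V with |P+ v| = |P- v| for all v in V is exactly the graph of the
    isometry P+ v |-> P- v defined on P+ V, which has the dimension of V. *)

(** * Quadratic forms and ranges of matrices acting on columns *)

Section ColumnForms.
Local Set Implicit Arguments.
Local Unset Strict Implicit.
Local Open Scope sesquilinear_scope.
Variables (C : numClosedFieldType) (N : nat).
Implicit Types (K M P : 'M[C]_N) (u v w : 'cV[C]_N).

Lemma hermsymmxP M : reflect (M ^t* = M) (M \is hermsymmx).
Proof.
by apply: (iffP (is_hermitianmxP _ _ _)); rewrite expr0 scale1r.
Qed.

Lemma enorm_eq v w : enorm v = enorm w <-> v ^t* *m v = w ^t* *m w.
Proof.
have sqE u : (u ^t* *m u) 0 0 = \sum_(i < N) `|u i 0| ^+ 2.
  by rewrite mxE; apply: eq_bigr => i _; rewrite !mxE normCK mulrC.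
split=> [/(congr1 (fun x => x ^+ 2))|e].
  by rewrite !sqrtCK -!sqE => e; apply/matrixP => i j; rewrite !ord1.
by rewrite /enorm -!sqE e.
Qed.

(* Polarisation: the values at u + v and u + i v determine the form. *)
Lemma quad_form_eq0 K : (forall u, u ^t* *m K *m u = 0) -> K = 0.
Proof.
move=> K0; have sesq u v : u ^t* *m K *m v = 0.
  have conjD a : (u + a *: v) ^t* = u ^t* + a^* *: v ^t*.
    by rewrite linearD linearZ map_mxD map_mxZ.
  have E a : a *: (u ^t* *m K *m v) + a^* *: (v ^t* *m K *m u) = 0.
    move: (K0 (u + a *: v)); rewrite conjD !mulmxDl !mulmxDr -!scalemxAl.
    by rewrite -!scalemxAr !K0 !scaler0 add0r addr0.
  have := E 'i%R; rewrite conjCi; have := E 1; rewrite conjC1 !scale1r.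
  move/eqP; rewrite addr_eq0 => /eqP ->; move/eqP.
  rewrite scaleNr scalerN -opprD oppr_eq0 -scalerDl scaler_eq0.
  rewrite -mulr2n mulrn_eq0 (negPf (neq0Ci C)) /= => /eqP ->.
  by rewrite oppr0.
apply/matrixP => i j; have := sesq (delta_mx i 0) (delta_mx j 0).
rewrite -colE => /matrixP/(_ 0 0); rewrite !mxE => <-.
rewrite (bigD1 i) //= big1 ?addr0 => [|l li].
  by rewrite !mxE !eqxx /= conjC1 mul1r.
by rewrite !mxE (negPf li) /= conjC0 mul0r.
Qed.

(** In the factorisation of [P] as [col_base P *m row_base P] the left factor is injective and the
    right one surjective, so [P] has the same image as [col_base P]. *)
Lemma dim_limg_mxop P : \dim (limg (mxop P)) = \rank P.
Proof.
pose f : 'Hom('cV[C]_(\rank P), 'cV[C]_N) := linfun (mulmx (col_base P)).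
have fE (x : 'cV_(\rank P)) : f x = col_base P *m x by rewrite lfunE.
have kf : lker f == 0%VS.
  apply/lker0P => x y; rewrite !fE => e.
  have /row_fullP[D DP] := col_base_full P.
  by rewrite -[x]mul1mx -DP -mulmxA e mulmxA DP mul1mx.
suff -> : limg (mxop P) = limg f.
  by rewrite limg_dim_eq ?(eqP kf) ?capv0 // dimvf dim_matrix mulr1.
have /row_freeP[D PD] := row_base_free P.
apply/vspaceP => v; apply/memv_imgP/memv_imgP => -[u _ ->].
  by exists (row_base P *m u); rewrite ?memvf // fE mxopE mulmxA mulmx_base.
exists (D *m u); rewrite ?memvf // fE mxopE mulmxA.
have /(congr1 (mulmx^~ D)) := mulmx_base P.
by rewrite -mulmxA PD mulmx1 => <-.
Qed.

Lemma mem_limg_idem P v : P *m P = P ->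
  v \in limg (mxop P) -> P *m v = v.
Proof. by move=> PP /memv_imgP[u _ ->]; rewrite !mxopE mulmxA PP. Qed.

Lemma mulmx_limg P v : P *m v \in limg (mxop P).
Proof. by rewrite -mxopE memv_img ?memvf. Qed.

End ColumnForms.

(** * Functional calculus and spectral projections of normal matrices *)

Section FunCalc.
Local Set Implicit Arguments.
Local Unset Strict Implicit.
Local Open Scope sesquilinear_scope.
Variables (C : numClosedFieldType) (N : nat).
Implicit Types (B : 'M[C]_N) (f g : C -> C) (S : pred C).

Lemma funcalcM f g B :
  funcalc f B *m funcalc g B = funcalc (fun x => f x * g x) B.
Proof.
rewrite /funcalc !mulmxA mulmxK ?spectral_unit //.
rewrite -(mulmxA _ (diag_mx _) (diag_mx _)).
rewrite mulmx_diag; congr (_ *m diag_mx _ *m _).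
by apply/rowP => i; rewrite !mxE.
Qed.

(** Only values on the spectrum count, so scalar identities that fail at 0 still transfer to a [B]
    with no eigenvalue 0. *)
Lemma eq_funcalc f g B :
  (forall i, f (spectral_diag B 0 i) = g (spectral_diag B 0 i)) ->
  funcalc f B = funcalc g B.
Proof.
move=> fg; congr (_ *m diag_mx _ *m _).
by apply/rowP => i; rewrite !mxE.
Qed.

Lemma funcalcD f g B :
  funcalc f B + funcalc g B = funcalc (fun x => f x + g x) B.
Proof.
rewrite /funcalc -mulmxDl -mulmxDr -raddfD; congr (_ *m diag_mx _ *m _).
by apply/rowP => i; rewrite !mxE.
Qed.

Lemma funcalcN f B : - funcalc f B = funcalc (fun x => - f x) B.
Proof.
rewrite /funcalc -mulNmx -mulmxN -raddfN; congr (_ *m diag_mx _ *m _).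
by apply/rowP => i; rewrite !mxE.
Qed.

Lemma funcalc1 B : funcalc (fun=> 1) B = 1%:M.
Proof.
rewrite /funcalc (_ : map_mx _ _ = const_mx 1).
  by rewrite diag_const_mx mulmx1 mulVmx ?spectral_unit.
by apply/rowP => i; rewrite !mxE.
Qed.

Lemma funcalc_id B : B \is normalmx -> funcalc id B = B.
Proof.
by move=> nB; rewrite /funcalc map_mx_id; first exact/esym/orthomx_spectralP.
Qed.

Lemma funcalc_herm f B : (forall x, f x \is Num.real) ->
  (funcalc f B) ^t* = funcalc f B.
Proof.
(* [spectralmx B] is unitary, so the adjoint only conjugates the diagonal, which is real. *)
move=> fR; rewrite /funcalc invmx_unitary ?spectral_unitarymx //.
rewrite !trC_mul trmxCK mulmxA tr_diag_mx map_diag_mx.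
congr (_ *m diag_mx _ *m _); apply/rowP => i; rewrite !mxE.
exact: CrealP.
Qed.

(** As [B] is the diagonal matrix conjugated by [spectralmx B], the columns of the inverse of
    [spectralmx B] form an eigenbasis. *)
Lemma spectral_col_eigen B i : B \is normalmx ->
  B *m col i (invmx (spectralmx B))
    = spectral_diag B 0 i *: col i (invmx (spectralmx B)).
Proof.
move=> nB; rewrite {1}(orthomx_spectralP nB) !colE -!mulmxA.
rewrite (mulmxA (spectralmx B)) mulmxV ?spectral_unit // mul1mx.
suff -> : diag_mx (spectral_diag B) *m (delta_mx i 0 : 'cV_N)
    = spectral_diag B 0 i *: delta_mx i 0 by rewrite -scalemxAr.
apply/colP => j; rewrite mul_diag_mx !mxE.
by case: (eqVneq j i) => [->|]; rewrite ?mulr0.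
Qed.

Lemma spectral_col_neq0 B i : col i (invmx (spectralmx B)) != 0.
Proof.
apply/eqP => /(congr1 (mulmx (spectralmx B))).
rewrite mulmx0 colE mulmxA mulmxV ?spectral_unit // mul1mx => /colP/(_ i)/eqP.
by rewrite !mxE eqxx oner_eq0.
Qed.

Lemma mulmx_sum_col m n (X : 'M[C]_(m, n)) (w : 'cV[C]_n) :
  X *m w = \sum_i w i 0 *: col i X.
Proof.
apply/colP => i; rewrite mxE summxE; apply: eq_bigr => j _.
by rewrite !mxE mulrC.
Qed.

(** An eigenvector with eigenvalue in [S] is fixed by the indicator of [S]. Conversely, a vector of
    the image, expanded in the eigenbasis, has zero coefficient at every eigenvalue outside [S]. *)
Lemma limg_funcalc_indicator S B : B \is normalmx ->
  limg (mxop (funcalc (fun x => (S x)%:R) B)) = eigspan S B.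
Proof.
move=> nB; apply/eqP; rewrite eqEsubv; apply/andP; split; last first.
  apply/(eigspanP _ _ nB) => mu v Smu e.
  apply/memv_imgP; exists v; rewrite ?memvf // mxopE.
  by rewrite (funcalc_eigen _ nB e) Smu scale1r.
apply/subvP => _ /memv_imgP[v _ ->]; rewrite mxopE /funcalc -!mulmxA.
set w := diag_mx _ *m _; rewrite mulmx_sum_col; apply: memv_suml => i _.
rewrite /w mul_diag_mx !mxE; case: (boolP (S _)) => Si; last first.
  by rewrite mul0r scale0r mem0v.
apply: memvZ; apply: (subvP (sumv_sup i Si (subvv _))).
rewrite memv_ker add_lfunE opp_lfunE scale_lfunE.
by rewrite id_lfunE mxopE spectral_col_eigen // subrr.
Qed.

Lemma funcalc_indicator_idem S B :
  let E := funcalc (fun x => (S x)%:R) B in E *m E = E.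
Proof.
by rewrite /= funcalcM; apply: eq_funcalc => i; case: S; rewrite ?mulr0 ?mulr1.
Qed.

Lemma funcalc_indicator_herm S B :
  (funcalc (fun x => (S x)%:R) B) ^t* = funcalc (fun x => (S x)%:R) B.
Proof. by apply: funcalc_herm => x; exact: realn. Qed.

Lemma orthoproj_eigspan S B : B \is normalmx ->
  orthoproj (eigspan S B) = funcalc (fun x => (S x)%:R) B.
Proof.
move=> nB; apply/esym/orthoproj_uniq; last exact: limg_funcalc_indicator.
split; first exact: funcalc_indicator_idem.
by apply/hermsymmxP; exact: funcalc_indicator_herm.
Qed.

End FunCalc.

(** * Neutral subspaces of the form [Pp - Pm] as graphs of isometries *)

Section IsometryGraph.
Local Set Implicit Arguments.
Local Unset Strict Implicit.
Local Open Scope sesquilinear_scope.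
Variables (C : numClosedFieldType) (N : nat).

(** An isometry is injective. This yields the bound on the dimension of the negative eigenspace. *)
Lemma isometry_dim_le (V1 V2 : {vspace 'cV[C]_N})
    (U : 'Hom(subvs_of V1, subvs_of V2)) :
  is_isometry U -> (\dim V1 <= \dim V2)%N.
Proof.
move=> isoU; have kU : lker U == 0%VS.
  rewrite -subv0; apply/subvP => x; rewrite memv_ker memv0 => /eqP Ux.
  apply/eqP/subvs_inj/col_gram_eq0.
  by rewrite -(proj1 (enorm_eq _ _) (isoU x)) Ux linear0.
have -> : \dim V1 = \dim (limg U).
  by rewrite limg_dim_eq ?(eqP kU) ?capv0 // dimvf.
by rewrite (leq_trans (dimvS (subvf _))) // dimvf.
Qed.

Variables Pp Pm : 'M[C]_N.
Hypotheses (PpI : Pp *m Pp = Pp) (PmI : Pm *m Pm = Pm).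
Hypotheses (PpH : Pp ^t* = Pp) (PmH : Pm ^t* = Pm) (PpDm : Pp + Pm = 1%:M).

Let PpPm : Pp *m Pm = 0.
Proof.
have /(congr1 (mulmx Pp))/eqP := PpDm.
by rewrite mulmxDr PpI mulmx1 -subr_eq0 addrAC subrr add0r => /eqP.
Qed.

Let PmPp : Pm *m Pp = 0.
Proof. by rewrite -PmH -PpH -trC_mul PpPm trmx0 map_mx0. Qed.

(** Both matrices are Hermitian idempotents, so the form is the difference of the squared norms of
    [Pp *m v] and [Pm *m v]. *)
Lemma neutral_normP v :
  v ^t* *m (Pp - Pm) *m v = 0 <-> enorm (Pm *m v) = enorm (Pp *m v).
Proof.
rewrite enorm_eq !trC_mul PpH PmH !mulmxA -!(mulmxA _ Pm Pm) -!(mulmxA _ Pp Pp).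
rewrite PpI PmI mulmxBr mulmxBl; split=> [/eqP|->]; last exact: subrr.
by rewrite subr_eq0 => /eqP.
Qed.

Section Graph.
Variables (Vp : {vspace 'cV[C]_N}).
Variable U : 'Hom(subvs_of Vp, subvs_of (limg (mxop Pm))).
Hypothesis sVp : (Vp <= limg (mxop Pp))%VS.

(** [Pp] fixes [Vp] and kills the range of [Pm], so it recovers the base point of a graph vector; it
    is thus a left inverse of the graph map, which gives the dimension of the graph. *)
Let PpE (x : subvs_of Vp) : Pp *m (vsval x + vsval (U x)) = vsval x.
Proof.
rewrite mulmxDr (mem_limg_idem PpI) ?(subvP sVp) ?subvsP //.
by rewrite -(mem_limg_idem PmI (subvsP (U x))) mulmxA PpPm mul0mx addr0.
Qed.

Let PmE (x : subvs_of Vp) : Pm *m (vsval x + vsval (U x)) = vsval (U x).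
Proof.
rewrite mulmxDr (mem_limg_idem PmI (subvsP _)).
have /(mem_limg_idem PpI) <- : vsval x \in limg (mxop Pp).
  by rewrite (subvP sVp) ?subvsP.
by rewrite mulmxA PmPp mul0mx add0r.
Qed.

Lemma sumgraph_neutral v : is_isometry U -> v \in sumgraph U ->
  v ^t* *m (Pp - Pm) *m v = 0.
Proof.
move=> isoU /memv_sumgraph[x ->].
by apply/neutral_normP; rewrite PpE PmE isoU.
Qed.

Lemma dim_sumgraph : \dim (sumgraph U) = \dim Vp.
Proof.
rewrite limg_dim_eq ?dimvf //; apply/eqP; rewrite capfv; apply/lker0P => x y.
rewrite !add_lfunE !comp_lfunE !lfunE /= => e.
by apply: subvs_inj; rewrite -PpE e PpE.
Qed.

End Graph.

Lemma neutral_sumgraph (V : {vspace 'cV[C]_N}) :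
  (forall v, v \in V -> v ^t* *m (Pp - Pm) *m v = 0) ->
  exists (Vp : {vspace 'cV[C]_N})
         (U : 'Hom(subvs_of Vp, subvs_of (limg (mxop Pm)))),
    [/\ (Vp <= limg (mxop Pp))%VS, \dim Vp = \dim V, is_isometry U
      & sumgraph U = V].
Proof.
move=> nV.
pose f : 'Hom(subvs_of V, 'cV[C]_N) := (mxop Pp \o linfun vsval)%VF.
have fE x : f x = Pp *m vsval x by rewrite comp_lfunE mxopE lfunE.
(* A neutral vector killed by [Pp] is killed by [Pm] too, hence is zero because [Pp + Pm] is the
   identity. *)
have kf : lker f == 0%VS.
  rewrite -subv0; apply/subvP => x; rewrite memv_ker memv0 fE => /eqP Ppx.
  apply/eqP/subvs_inj; rewrite linear0.
  have /neutral_normP/enorm_eq := nV _ (subvsP x).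
  rewrite Ppx mulmx0 => /col_gram_eq0 Pmx.
  by rewrite -[vsval x]mul1mx -PpDm mulmxDl Ppx Pmx addr0.
pose g : 'Hom('cV[C]_N, subvs_of (limg (mxop Pm))) :=
  (linfun (vsproj (limg (mxop Pm))) \o mxop Pm)%VF.
(* [U] takes [y] in the image of [f] to its preimage in [V], then applies [Pm]; [vsproj] inside [g]
   only changes the type, the value already lying in the range of [Pm]. *)
pose U : 'Hom(subvs_of (limg f), subvs_of (limg (mxop Pm))) :=
  (g \o linfun vsval \o f^-1 \o linfun vsval)%VF.
have fV (y : subvs_of (limg f)) : Pp *m vsval (f^-1%VF (vsval y)) = vsval y.
  by rewrite -fE limg_lfunVK ?subvsP.
have UE y : vsval (U y) = Pm *m vsval (f^-1%VF (vsval y)).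
  by rewrite !comp_lfunE !lfunE /= vsprojK // mulmx_limg.
have yUy y : vsval y + vsval (U y) = vsval (f^-1%VF (vsval y)).
  by rewrite UE -{1}fV -mulmxDl PpDm mul1mx.
exists (limg f), U; split.
- by rewrite limg_comp limgS ?subvf.
- by rewrite limg_dim_eq ?(eqP kf) ?capv0 // dimvf.
- move=> y; rewrite UE -[in RHS]fV.
  by apply/neutral_normP/nV/subvsP.
apply/vspaceP => v; apply/memv_sumgraph/idP => [[y ->]|vV].
  by rewrite yUy subvsP.
have fv : f (vsproj V v) \in limg f by rewrite memv_img ?memvf.
by exists (Subvs fv); rewrite yUy /= lker0_lfunK // vsprojK.
Qed.

End IsometryGraph.

(** * Passing from [A] to [A - lam%:M] *)

Section Shift.
Local Set Implicit Arguments.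
Local Unset Strict Implicit.
Local Open Scope sesquilinear_scope.
Variables (C : numClosedFieldType) (N k : nat) (A : 'M[C]_N) (lam : C).

Lemma leigenvalue_sub :
  passmx.leigenvalue (mxop (A - lam%:M)) 0 = passmx.leigenvalue (mxop A) lam.
Proof.
rewrite /passmx.leigenvalue /passmx.leigenspace.
suff -> : mxop (A - lam%:M) - 0 *: \1%VF = mxop A - lam *: \1%VF by [].
apply/lfunP => v; rewrite !add_lfunE !opp_lfunE !scale_lfunE !id_lfunE.
by rewrite !mxopE mulmxBl scale0r subr0 mul_scalar_mx.
Qed.

(** Taking adjoints in [P *m A *m P = lam *: P] replaces [lam] by its conjugate, and [P] is nonzero
    because its rank [k] is positive. *)
Lemma numrange_hermsymm_real : (0 < k)%N -> A \is hermsymmx ->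
  numrange k A lam -> lam \is Num.real.
Proof.
move=> k0 /hermsymmxP hA [P [[_ /hermsymmxP PH] rP PAP]]; apply/CrealP.
have /eqP := congr1 (fun X => X ^t*) PAP.
rewrite !trC_mul PH hA mulmxA PAP linearZ map_mxZ PH -subr_eq0 -scalerBl.
rewrite scaler_eq0 subr_eq0 => /orP[/eqP //|/eqP P0].
by move: k0; rewrite -rP P0 mxrank0.
Qed.

Lemma hermsymm_sub_scalar : A \is hermsymmx -> lam \is Num.real ->
  A - lam%:M \is hermsymmx.
Proof.
move=> /hermsymmxP hA /CrealP lamR; apply/hermsymmxP.
by rewrite linearB map_mxB hA /= tr_scalar_mx map_scalar_mx /= lamR.
Qed.

End Shift.

(** * The spectral projections and inverse square root of an invertible Hermitian matrix *)

Section InvertibleHermitian.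
Local Set Implicit Arguments.
Local Unset Strict Implicit.
Local Open Scope sesquilinear_scope.
Variables (C : numClosedFieldType) (N : nat) (B : 'M[C]_N).
Hypotheses (hB : B \is hermsymmx) (evB : ~~ passmx.leigenvalue (mxop B) 0).

Let nB : B \is normalmx. Proof. exact: hermitian_normalmx. Qed.

Lemma spectral_diag_neq0 i : spectral_diag B 0 i != 0.
Proof.
apply: contra evB => /eqP di; apply/negP => /eqP ker0.
case/negP: (spectral_col_neq0 B i); rewrite -memv0 -ker0 memv_ker.
rewrite add_lfunE opp_lfunE scale_lfunE id_lfunE mxopE spectral_col_eigen //.
by rewrite di subrr.
Qed.

Lemma spectral_diag_real i : spectral_diag B 0 i \is Num.real.
Proof. exact: (mxOverP (hermitian_spectral_diag_real hB)). Qed.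

Lemma posproj_funcalc : posproj B = funcalc (fun x => (0 < x)%R%:R) B.
Proof. exact: orthoproj_eigspan. Qed.

Lemma negproj_funcalc : negproj B = funcalc (fun x => (x < 0)%R%:R) B.
Proof. exact: orthoproj_eigspan. Qed.

(** The spectrum is real and omits 0, so on it the indicators of the positive and negative numbers
    add up to 1. *)
Lemma posprojD_negproj : posproj B + negproj B = 1%:M.
Proof.
rewrite posproj_funcalc negproj_funcalc funcalcD -[RHS](funcalc1 B).
apply: eq_funcalc => i.
have := spectral_diag_neq0 i; rewrite real_neqr_lt ?spectral_diag_real ?real0 //.
by case/orP => di; rewrite di (lt_gtF di) ?add0r ?addr0.
Qed.

Lemma abs_invsqrt_herm : (abs_invsqrt B) ^t* = abs_invsqrt B.
Proof.
apply: funcalc_herm => x; apply: ger0_real.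
by rewrite invr_ge0 sqrtC_ge0 normr_ge0.
Qed.

Lemma abs_invsqrtK :
  abs_invsqrt B *m funcalc (fun x => sqrtC `|x|) B = 1%:M.
Proof.
rewrite funcalcM -[RHS](funcalc1 B); apply: eq_funcalc => i.
by rewrite mulVf // sqrtC_eq0 normr_eq0 spectral_diag_neq0.
Qed.

(** On the spectrum, multiplying [x] twice by the inverse square root of its absolute value leaves
    the sign of [x], which is the difference of the two indicators. *)
Lemma abs_invsqrt_congr :
  abs_invsqrt B *m B *m abs_invsqrt B = posproj B - negproj B.
Proof.
rewrite -{2}(funcalc_id nB) !funcalcM posproj_funcalc negproj_funcalc.
rewrite funcalcN funcalcD; apply: eq_funcalc => i.
set d := spectral_diag B 0 i.
rewrite mulrAC -invfM -expr2 sqrtCK mulrC.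
have d0 : d != 0 := spectral_diag_neq0 i.
move: (d0); rewrite real_neqr_lt ?spectral_diag_real ?real0 // => /orP[] di.
  by rewrite di (lt_gtF di) ltr0_norm // invrN mulrN divff // sub0r.
by rewrite di (lt_gtF di) gtr0_norm // divff // subr0.
Qed.

End InvertibleHermitian.

(** * The correspondence between compressions and isometries, over any closed numeric field *)

Theorem rank_numrange_graph (C : numClosedFieldType) (N k : nat)
    (A : 'M[C]_N) (lam : C) (hA : A \is hermsymmx) (hk : (1 <= k)%N)
    (hlam : numrange k A lam) (hev : ~~ passmx.leigenvalue (mxop A) lam) :
  let B : 'M[C]_N := A - lam%:M in
  let Epos := limg (mxop (posproj B)) in
  let Eneg := limg (mxop (negproj B)) in
  ([/\ (k <= \dim Epos)%N, (k <= \dim Eneg)%N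
     & forall (Vp : {vspace 'cV[C]_N})
              (U : 'Hom(subvs_of Vp, subvs_of Eneg)),
         (Vp <= Epos)%VS -> \dim Vp = k -> is_isometry U ->
         let W := (mxop (abs_invsqrt B) @: sumgraph U)%VS in
         \dim W = k /\
         orthoproj W *m A *m orthoproj W = lam *: orthoproj W])
  /\
  (forall P : 'M[C]_N,
     is_orthoproj P -> \rank P = k -> P *m A *m P = lam *: P ->
     exists (Vp : {vspace 'cV[C]_N})
            (U : 'Hom(subvs_of Vp, subvs_of Eneg)),
       [/\ (Vp <= Epos)%VS, \dim Vp = k, is_isometry U
         & P = orthoproj (mxop (abs_invsqrt B) @: sumgraph U)%VS]).
Proof.
move=> B Epos Eneg.
have hB : B \is hermsymmx.
  by exact/hermsymm_sub_scalar/(numrange_hermsymm_real hk hA hlam).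
have evB : ~~ passmx.leigenvalue (mxop B) 0 by rewrite leigenvalue_sub.
have [[PpI /hermsymmxP PpH] _] := orthoprojP (eigspan (fun x => 0 < x) B).
have [[PmI /hermsymmxP PmH] _] := orthoprojP (eigspan (fun x => x < 0) B).
rewrite -/(posproj B) in PpI PpH; rewrite -/(negproj B) in PmI PmH.
have PpDm := posprojD_negproj hB evB.
have SBS := abs_invsqrt_congr hB evB.
have SH := abs_invsqrt_herm B; have ST := abs_invsqrtK hB evB.
(* [T] is the square root of the absolute value of [B]; for square matrices a one-sided inverse is
   two-sided. *)
have TS := mulmx1C ST.
set S := abs_invsqrt B in SBS SH ST TS *.
set T := funcalc _ B in ST TS; clearbody S T.
have compB P : P *m P = P ->
    P *m A *m P = lam *: P <-> P *m B *m P = 0.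
  move=> PP; rewrite /B mulmxBr mulmxBl mul_mx_scalar -scalemxAl PP.
  by split=> [->|/eqP]; rewrite ?subrr // subr_eq0 => /eqP.
(* The converse comes first, since the dimension bounds of (1) follow by applying it to a projection
   witnessing [hlam]. *)
have conv P : is_orthoproj P -> \rank P = k -> P *m A *m P = lam *: P ->
     exists (Vp : {vspace 'cV[C]_N})
            (U : 'Hom(subvs_of Vp, subvs_of Eneg)),
       [/\ (Vp <= Epos)%VS, \dim Vp = k, is_isometry U
         & P = orthoproj (mxop S @: sumgraph U)%VS].
  move=> [PP PH] rP /(compB _ PP) PBP.
  pose V := (mxop T @: limg (mxop P))%VS.
  have SV : (mxop S @: V)%VS = limg (mxop P).
    rewrite /V -limg_comp -[RHS]lim1g; congr (lfun_img _ _); apply/lfunP => v.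
    by rewrite comp_lfunE id_lfunE !mxopE mulmxA ST mul1mx.
  have kT : lker (mxop T) == 0%VS.
    apply/lker0P => x y; rewrite !mxopE => /(congr1 (mulmx S)).
    by rewrite !mulmxA ST !mul1mx.
  (* With [w = S *m v], fixed by [P], the form at [v] equals that of [B] at [w], hence that of
     [P *m B *m P] at [w], which is zero. *)
  have nV v : v \in V -> (v ^t*)%sesqui *m (posproj B - negproj B) *m v = 0.
    move=> vV; have : S *m v \in limg (mxop P) by rewrite -SV -mxopE memv_img.
    move=> /(mem_limg_idem PP) PSv.
    rewrite -SBS !mulmxA -(mulmxA _ S v) -{1}SH -trC_mul.
    by rewrite -PSv trC_mul (hermsymmxP _ PH) !mulmxA -(mulmxA _ P B)
      -(mulmxA _ (P *m B)) PBP mulmx0 !mul0mx.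
  have [Vp [U [sVp dVp isoU gU]]] := neutral_sumgraph PpI PmI PpH PmH PpDm nV.
  exists Vp, U; split => //; last first.
    by rewrite gU SV; exact: orthoproj_uniq.
  by rewrite dVp limg_dim_eq ?(eqP kT) ?capv0 // dim_limg_mxop.
split=> //; have [P [oP rP PAP]] := hlam.
have [Vp0 [U0 [sVp0 dVp0 isoU0 _]]] := conv P oP rP PAP.
split; first by rewrite -dVp0 dimvS.
  by rewrite -dVp0 (isometry_dim_le isoU0).
move=> Vp U sVp dVp isoU W; split.
  have kS : lker (mxop S) == 0%VS.
    apply/lker0P => x y; rewrite !mxopE => /(congr1 (mulmx T)).
    by rewrite !mulmxA TS !mul1mx.
  rewrite limg_dim_eq ?(eqP kS) ?capv0 //.
  by rewrite (dim_sumgraph PpI PmI PpDm).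
have [[QQ /hermsymmxP QH] QW] := orthoprojP W.
set Q := orthoproj W in QQ QH QW *; clearbody Q.
(* It suffices that the form of [Q *m B *m Q] vanishes at each [u]. As [Q *m u] is [S *m v] for some
   [v] in the graph, its value is that of the form [posproj B - negproj B] at [v]. *)
apply/(compB _ QQ)/quad_form_eq0 => u.
have /memv_imgP[v vV Qu] : Q *m u \in W by rewrite -QW mulmx_limg.
rewrite -{1}QH !mulmxA -trC_mul -(mulmxA _ Q u) Qu mxopE trC_mul SH.
rewrite !mulmxA -(mulmxA _ S B) -(mulmxA _ (S *m B)) SBS.
exact: (sumgraph_neutral PpI PmI PpH PmH PpDm sVp isoU).
Qed.

Theorem mainTheorem2 (R : realType) (N k : nat) (A : 'M[R[i]]_N) (lam : R[i])
    (hA : A \is hermsymmx) (hk : (1 <= k)%N)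
    (hlam : numrange k A lam) (hev : ~~ passmx.leigenvalue (mxop A) lam) :
  let B : 'M[R[i]]_N := A - lam%:M in
  let Epos := limg (mxop (posproj B)) in
  let Eneg := limg (mxop (negproj B)) in
  ([/\ (k <= \dim Epos)%N, (k <= \dim Eneg)%N
     & forall (Vp : {vspace 'cV[R[i]]_N})
              (U : 'Hom(subvs_of Vp, subvs_of Eneg)),
         (Vp <= Epos)%VS -> \dim Vp = k -> is_isometry U ->
         let W := (mxop (abs_invsqrt B) @: sumgraph U)%VS in
         \dim W = k /\
         orthoproj W *m A *m orthoproj W = lam *: orthoproj W])
  /\
  (forall P : 'M[R[i]]_N,
     is_orthoproj P -> \rank P = k -> P *m A *m P = lam *: P ->
     exists (Vp : {vspace 'cV[R[i]]_N})
            (U : 'Hom(subvs_of Vp, subvs_of Eneg)),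
       [/\ (Vp <= Epos)%VS, \dim Vp = k, is_isometry U
         & P = orthoproj (mxop (abs_invsqrt B) @: sumgraph U)%VS]).
Proof. exact: rank_numrange_graph hA hk hlam hev. Qed.
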